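(* Let $M$ be a compact Riemannian manifold of dimension $d\ge 1$, let $f:M\to M$ be a $C^1$ map, and let $\Lambda\subseteq M$ be a compact invariant set which contains no critical points of $f$. Suppose that every $\lambda'\in\mathcal L(f)$ satisfies $\lambda'>0$. Then there exists a constant $\lambda>0$ such that every $\lambda'\in\mathcal L(f)$ satisfies $\lambda'>\lambda$.
   Context: Invariant means $f(\Lambda)\subseteq\Lambda$. A point $x$ is a critical point of $f$ if $\det Df_x=0$. $\mathcal L(f)$ denotes the set of all Lyapunov exponents of $f$ on $\Lambda$: the set of all $\lambda\in\mathbb R$ for which there exist a point $x\in\Lambda$ and a nonzero vector $v\in T_xM$ such that the limit $\lim_{n\to\infty}\frac1n\log\|Df^n_x(v)\|$ exists and equals $\lambda$. *)

(* Defs.v *)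
(* Manifolds are modelled on row vectors 'rV[R]_d over R : realType. *)
From mathcomp Require Import all_boot all_order all_algebra.
From mathcomp Require Import all_classical all_reals all_analysis.

Set Implicit Arguments.
Unset Strict Implicit.
Unset Printing Implicit Defensive.

Import Order.TTheory GRing.Theory Num.Theory.
Import numFieldNormedType.Exports.
Local Open Scope classical_set_scope.
Local Open Scope ring_scope.

(* For V finite-dimensional and U open this is the usual notion of a C^k map
   on U: continuity of all the directional derivatives is continuity of the
   Frechet derivative. Values of f outside U are irrelevant. *)
Fixpoint Ck_on (R : realType) (V W : normedModType R) (k : nat)
    (U : set V) (f : V -> W) : Prop :=
  match k with
  | 0 => forall x, U x -> {for x, continuous f}
  | k'.+1 => (forall x, U x -> differentiable f x) /\
             (forall v : V, Ck_on k' U (fun x => 'D_v f x))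
  end.

Definition smooth_on (R : realType) (V W : normedModType R)
    (U : set V) (f : V -> W) : Prop :=
  forall k, Ck_on k U f.

(* A chart is a homeomorphism between the open sets chart_dom and chart_cod;
   coord and param are total, with junk values off these sets. *)
Record chart (R : realType) (d : nat) (M : topologicalType) := Chart {
  chart_dom : set M ;
  chart_cod : set 'rV[R]_d ;
  coord : M -> 'rV[R]_d ;
  param : 'rV[R]_d -> M ;
  chart_dom_open : open chart_dom ;
  chart_cod_open : open chart_cod ;
  coord_cod : forall x, chart_dom x -> chart_cod (coord x) ;
  param_dom : forall y, chart_cod y -> chart_dom (param y) ;
  coordK : forall x, chart_dom x -> param (coord x) = x ;
  paramK : forall y, chart_cod y -> coord (param y) = y ;
  coord_continuous : forall x, chart_dom x -> {for x, continuous coord} ;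
  param_continuous : forall y, chart_cod y -> {for y, continuous param}
}.

Definition local_rep (R : realType) (d : nat) (M : topologicalType)
    (a b : chart R d M) (f : M -> M) : 'rV[R]_d -> 'rV[R]_d :=
  fun y => coord b (f (param a y)).

Definition local_rep_dom (R : realType) (d : nat) (M : topologicalType)
    (a b : chart R d M) (f : M -> M) : set 'rV[R]_d :=
  [set y | chart_cod a y /\ chart_dom b (f (param a y))].

(* Smooth d-manifold structure (without boundary) on M. The function chart_at
   selects one chart of the atlas around each point; it is used to identify
   the tangent space T_xM with 'rV[R]_d. *)
Record smooth_manifold (R : realType) (d : nat) (M : topologicalType) :=
  SmoothManifold {
  manifold_hausdorff : hausdorff_space M ;
  manifold_second_countable : @second_countable M ;
  atlas : set (chart R d M) ;
  chart_at : M -> chart R d M ;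
  chart_at_atlas : forall x, atlas (chart_at x) ;
  chart_at_dom : forall x, chart_dom (chart_at x) x ;
  atlas_smooth : forall a b, atlas a -> atlas b ->
    smooth_on (local_rep_dom a b id) (local_rep a b id)
}.

(* T_xM, a vector being given by its coordinates in the chart chart_at S x. *)
Definition tangent (R : realType) (d : nat) (M : topologicalType)
    (S : smooth_manifold R d M) (x : M) := 'rV[R]_d.

(* The tangent vector at param a y whose coordinates in the chart a are u. *)
Definition tangent_of_chart (R : realType) (d : nat) (M : topologicalType)
    (S : smooth_manifold R d M) (a : chart R d M) (y u : 'rV[R]_d) :
    tangent S (param a y) :=
  'd (local_rep a (chart_at S (param a y)) id) y u.

Record riemannian_metric (R : realType) (d : nat) (M : topologicalType)
    (S : smooth_manifold R d M) := RiemannianMetric {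
  metric : forall x : M, tangent S x -> tangent S x -> R ;
  metric_linear : forall (x : M) (c : R) (u v w : 'rV[R]_d),
    @metric x (c *: u + v) w = c * @metric x u w + @metric x v w ;
  metric_sym : forall (x : M) (u v : 'rV[R]_d),
    @metric x u v = @metric x v u ;
  metric_pos : forall (x : M) (v : 'rV[R]_d), v != 0 -> 0 < @metric x v v ;
  metric_smooth : forall (a : chart R d M) (u v : 'rV[R]_d), atlas S a ->
    smooth_on (chart_cod a)
      (fun y => @metric (param a y) (tangent_of_chart S a y u)
                                    (tangent_of_chart S a y v))
}.

Definition tangent_norm (R : realType) (d : nat) (M : topologicalType)
    (S : smooth_manifold R d M) (g : riemannian_metric S) (x : M)
    (v : tangent S x) : R :=
  Num.sqrt (metric g v v).

Definition C1_map (R : realType) (d : nat) (M : topologicalType)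
    (S : smooth_manifold R d M) (f : M -> M) : Prop :=
  continuous f /\
  forall a b, atlas S a -> atlas S b ->
    Ck_on 1 (local_rep_dom a b f) (local_rep a b f).

Definition tangent_map (R : realType) (d : nat) (M : topologicalType)
    (S : smooth_manifold R d M) (f : M -> M) (x : M) (v : tangent S x) :
    tangent S (f x) :=
  'd (local_rep (chart_at S x) (chart_at S (f x)) f) (coord (chart_at S x) x) v.

(* The vanishing of det Df_x does not depend on the bases of T_xM and
   T_{f x}M, hence not on the charts. *)
Definition critical_point (R : realType) (d : nat) (M : topologicalType)
    (S : smooth_manifold R d M) (f : M -> M) (x : M) : Prop :=
  \det (lin1_mx (@tangent_map R d M S f x)) = 0.

(* The extended logarithm is used, so that log 0 = -oo. *)
Definition lyapunov_exponents (R : realType) (d : nat) (M : topologicalType)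
    (S : smooth_manifold R d M) (g : riemannian_metric S) (f : M -> M)
    (L : set M) : set R :=
  [set l : R | exists (x : M) (v : 'rV[R]_d), [/\ L x, v != 0 &
    (fun n : nat => (n%:R^-1)%:E *
       lne (tangent_norm g (@tangent_map R d M S (iter n f) x v))%:E)%E
      @ \oo --> l%:E]].

(* Main.v *)
Require Import Defs.
From mathcomp Require Import all_boot all_order all_algebra.
From mathcomp Require Import all_classical all_reals all_analysis.
From mathcomp Require Import ring lra.

(** Let E be the set of tangent vectors (x, v) with x in Lam and v nonzero; the
    tangent map Df acts on E because Lam is invariant and has no critical
    points. With q(x, v) the squared length of v, the numbers
    S_n(p) = log q(Df^n p) - log q(p) are Birkhoff sums along the orbit of p, and
    the Lyapunov exponent of p is half the limit of S_n(p) / n. The point is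
    that the infimum of the exponents is attained, so that it is positive.

    Let alpha be the supremum of the uniform rates, that is, of the a such
    that S_n >= a n - C on E for some constant C. Every limit of S_n(p) / n is
    at least alpha, so alpha is finite as soon as there is an exponent.
    Suppose that each p in E had some n with S_n(p) > alpha n. Since S_n is
    invariant under scaling of v, it lives on the unit sphere bundle over Lam,
    which is compact; hence finitely many strict inequalities S_n > (alpha +
    eps) n would suffice for all of E, and cutting orbits at the corresponding
    return times makes alpha + eps a uniform rate: a contradiction. So some p
    satisfies S_n(p) <= alpha n for all n (exists_slow_point), and together
    with the lower bounds S_n(p) >= a n - C for a < alpha this forces S_n(p) /
    n to converge to alpha (minimal_birkhoff_limit). Thus alpha / 2 is itself
    an exponent and is positive by hypothesis.

    The geometric part consists of the functoriality of the tangent map for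
    differentiable maps (bundle_map_comp, bundle_map_frame), which rests on the
    chain rule in charts; of the joint continuity of q o Df^n in local frames
    (bundle_continuous_iter, bundle_continuous_metric); and of the compactness
    of the unit sphere bundle, expressed by finite subcovers of E by conical
    open sets (nonzero_cover). *)

Set Implicit Arguments.
Unset Strict Implicit.
Unset Printing Implicit Defensive.

Import Order.TTheory GRing.Theory Num.Theory.
Import numFieldNormedType.Exports.
Local Open Scope classical_set_scope.
Local Open Scope ring_scope.

(** * Minimal Birkhoff averages *)

Lemma cvg_divn0 (R : realType) (C : R) : C * n%:R^-1 @[n --> \oo] --> (0 : R).
Proof.
rewrite -[X in _ --> X](mulr0 C); apply: cvgM; first exact: cvg_cst.
apply/gtr0_cvgV0; last exact: cvgr_idn.
by near=> n; rewrite ltr0n; near: n; exact: nbhs_infty_gt.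
Unshelve. all: by end_near.
Qed.

Definition birkhoff_sum (R : realType) (X : Type) (T : X -> X) (phi : X -> R)
    (n : nat) (p : X) : R :=
  \sum_(i < n) phi (iter i T p).

(** Countable compactness of E for the sets where a Birkhoff sum exceeds a
    constant. This is all of the topology of E that the argument uses, and it
    spares the construction of a topology on the tangent bundle. *)
Definition birkhoff_compact (R : realType) (X : Type) (T : X -> X)
    (phi : X -> R) (E : set X) : Prop :=
  forall (m : nat -> nat) (c : nat -> R),
    (forall p, E p -> exists i, c i < birkhoff_sum T phi (m i) p) ->
    exists k, forall p, E p ->
      exists2 i, (i < k)%N & c i < birkhoff_sum T phi (m i) p.

Section BirkhoffSums.
Variables (R : realType) (X : Type) (T : X -> X) (phi : X -> R) (E : set X).
Hypothesis ET : forall p, E p -> E (T p).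
Local Notation S := (birkhoff_sum T phi).

Lemma iter_invariant n p : E p -> E (iter n T p).
Proof. by move=> Ep; elim: n => //= n IH; exact: ET. Qed.

Lemma birkhoff_sumD m n p : S (m + n) p = S m p + S n (iter m T p).
Proof.
rewrite /birkhoff_sum big_split_ord /=; congr (_ + _).
by apply: eq_bigr => i _; rewrite addnC iterD.
Qed.

Definition uniform_rate (a : R) : Prop :=
  exists C : R, forall n p, E p -> a * n%:R - C <= S n p.

(** The sets where the first sum exceeds - i cover E, so phi is bounded below
    on E. *)
Lemma birkhoff_lower_bound : birkhoff_compact T phi E ->
  exists2 b : R, 0 <= b & forall n p, E p -> - (b * n%:R) <= S n p.
Proof.
move=> Hc.
have [p Ep|k Hk] := Hc (fun=> 1%N) (fun i => - i%:R).
  exists (Num.bound `|S 1 p|); apply: (@lt_le_trans _ _ (- `|S 1 p|)).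
    by rewrite ltrN2 archi_boundP.
  by rewrite lerNl -normrN ler_norm.
exists k%:R => // n; elim: n => [|n IH] p Ep.
  by rewrite mulr0 oppr0 /birkhoff_sum big_ord0.
rewrite -(add1n n) birkhoff_sumD natrD mulrDr mulr1 opprD lerD //; last first.
  exact/IH/ET.
have [i ik /ltW iS] := Hk _ Ep.
by apply: le_trans iS; rewrite lerN2 ler_nat ltnW.
Qed.

(** An orbit segment is cut greedily into blocks of length at most K on which the
    rate is at least a; only the last, incomplete block is lost, and it costs a
    bounded amount by birkhoff_lower_bound. *)
Lemma uniform_rate_of_return (a : R) (K : nat) : birkhoff_compact T phi E ->
  (forall p, E p -> exists n, (0 < n <= K)%N /\ a * n%:R <= S n p) ->
  uniform_rate a.
Proof.
move=> /birkhoff_lower_bound[b b0 Hb] Ha; exists ((b + `|a|) * K%:R).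
elim/ltn_ind => n IH p Ep.
have [nK|Kn] := leqP n K.
  apply: le_trans (Hb n p Ep).
  have : (n%:R : R) <= K%:R by rewrite ler_nat.
  have : a * n%:R <= `|a| * n%:R by rewrite ler_wpM2r // ler_norm.
  have := normr_ge0 a; move: `|a| (n%:R : R) (K%:R : R) => A N L.
  by nra.
have [m [/andP[m0 mK] Sm]] := Ha _ Ep.
have mn : (m <= n)%N := leq_trans mK (ltnW Kn).
have /IH/(_ (iter m T p)) : (n - m < n)%N by rewrite ltn_subrL m0 (leq_trans m0).
move=> /(_ (iter_invariant m Ep)) H.
rewrite -(subnKC mn) birkhoff_sumD natrD mulrDr -addrA lerD //.
Qed.

Lemma uniform_rate_le_limit (a l : R) p : uniform_rate a -> E p ->
  S n p / n%:R @[n --> \oo] --> l -> a <= l.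
Proof.
move=> [C HC] Ep Sl.
have : a - C * n%:R^-1 @[n --> \oo] --> a.
  rewrite -[X in _ --> X]subr0; apply: cvgB; first exact: cvg_cst.
  exact: cvg_divn0.
move=> /ler_cvg_to/(_ Sl); apply; near=> n.
have n0 : (0 : R) < n%:R by rewrite ltr0n; near: n; exact: nbhs_infty_gt.
rewrite ler_pdivlMr // mulrBl -mulrA mulVf ?gt_eqF// mulr1.
exact: HC.
Unshelve. all: by end_near.
Qed.

(** Finitely many strict inequalities leave room for a common larger rate. *)
Lemma finite_slack (alpha : R) (m : nat -> nat) (c : nat -> R) (k : nat) :
  (forall i, (0 < m i)%N /\ alpha * (m i)%:R < c i) ->
  exists a K, alpha < a /\
    forall i, (i < k)%N -> (m i <= K)%N /\ a * (m i)%:R <= c i.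
Proof.
move=> H; elim: k => [|k [a [K [aa HK]]]].
  by exists (alpha + 1), 0%N; split; [rewrite ltrDl|].
have [mk ck] := H k; have mk0 : (0 : R) < (m k)%:R by rewrite ltr0n.
exists (Num.min a (c k / (m k)%:R)), (maxn K (m k)); split.
  by rewrite lt_min aa ltr_pdivlMr.
move=> i; rewrite ltnS leq_eqVlt => /predU1P[->|/HK[mi ci]].
  by rewrite leq_maxr -ler_pdivlMr// ge_min lexx orbT.
rewrite (leq_trans mi) ?leq_maxl//; split=> //.
by apply: le_trans ci; rewrite ler_wpM2r// ge_min lexx.
Qed.

(** Otherwise the sets S n > (alpha + 1 / j) n, for positive n and j, cover E; a
    finite subcover yields a uniform rate larger than alpha. *)
Lemma exists_slow_point (alpha : R) : birkhoff_compact T phi E ->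
  (forall a, alpha < a -> ~ uniform_rate a) ->
  exists2 p, E p & forall n, S n p <= alpha * n%:R.
Proof.
move=> Hc Ha; apply: contrapT => Hno.
(* The cover is indexed by pairs (n, j), enumerated through pickle; code i stands
   for n = (code i).1.+1 and slack 1 / (code i).2.+1. Indices that encode
   no pair repeat the member for (0, 0). *)
pose code i : nat * nat := odflt (0, 0)%N (unpickle i).
pose m i := (code i).1.+1.
pose c i : R := (alpha + (code i).2.+1%:R^-1) * (m i)%:R.
have Hcover p : E p -> exists i, c i < S (m i) p.
  move=> Ep.
  have [n Sn] : exists n, alpha * n%:R < S n p.
    apply: contrapT => Hn; apply: Hno; exists p => // n.
    by rewrite leNgt; apply/negP => Hlt; apply: Hn; exists n.
  case: n Sn => [|n] Sn.
    by move: Sn; rewrite mulr0 /birkhoff_sum big_ord0 ltxx.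
  have n0 : (0 : R) < n.+1%:R by rewrite ltr0n.
  have e0 : 0 < S n.+1 p / n.+1%:R - alpha by rewrite subr_gt0 ltr_pdivlMr.
  have [j _ Hj] := near_infty_natSinv_lt (PosNum e0).
  exists (pickle (n, j)); rewrite /c /m /code pickleK /= -ltr_pdivlMr// -ltrBrDl.
  exact: (Hj j (leqnn j)).
have [k Hk] := Hc m c Hcover.
have [|a [K [aa HK]]] := @finite_slack alpha m c k.
  by move=> i; split=> //; rewrite ltr_pM2r ?ltr0n// ltrDl invr_gt0 ltr0n.
apply: (Ha a aa); apply: (@uniform_rate_of_return _ K) => // p Ep.
have [i ik /ltW ci] := Hk p Ep.
have [mK am] := HK i ik.
by exists (m i); rewrite mK; split=> //; exact: le_trans ci.
Qed.

(** The limit alpha is the supremum of the uniform rates; the given limit l0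
    serves to bound these rates from above. *)
Lemma minimal_birkhoff_limit (p0 : X) (l0 : R) : birkhoff_compact T phi E ->
  E p0 -> S n p0 / n%:R @[n --> \oo] --> l0 ->
  exists2 alpha : R,
    (exists2 p, E p & S n p / n%:R @[n --> \oo] --> alpha) &
    forall p l, E p -> S n p / n%:R @[n --> \oo] --> l -> alpha <= l.
Proof.
move=> Hc Ep0 Sl0; pose A := [set a : R | uniform_rate a].
have A0 : A !=set0.
  have [b _ Hb] := birkhoff_lower_bound Hc.
  by exists (- b), 0 => n p Ep; rewrite subr0 mulNr Hb.
have Aub : has_ubound A.
  by exists l0 => a Aa; exact: uniform_rate_le_limit Aa Ep0 Sl0.
exists (sup A); last first.
  move=> p l Ep Sl; apply: ge_sup => // a Aa.
  exact: uniform_rate_le_limit Aa Ep Sl.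
have [a Aa|p Ep Sp] := @exists_slow_point (sup A) Hc.
  by move=> /(ub_le_sup Aub); rewrite leNgt Aa.
exists p => //.
apply/cvgrPdist_le => e e0.
have e20 : 0 < e / 2 by rewrite divr_gt0.
have [a [C HC] asup] := sup_adherent e20 (conj A0 Aub).
have /cvgr0Pnorm_le/(_ _ e20) HCe := cvg_divn0 C; near=> n.
have n0 : (0 : R) < n%:R by rewrite ltr0n; near: n; exact: nbhs_infty_gt.
have upper : S n p / n%:R <= sup A by rewrite ler_pdivrMr.
rewrite ger0_norm ?subr_ge0// lerBlDr.
have lower : a - C * n%:R^-1 <= S n p / n%:R.
  by rewrite ler_pdivlMr// mulrBl -mulrA mulVf ?gt_eqF// mulr1; exact: HC.
have : C * n%:R^-1 <= e / 2.
  by apply: le_trans (ler_norm _) _; near: n.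
lra.
Unshelve. all: by end_near.
Qed.

End BirkhoffSums.

(** * Differentials and continuity in normed spaces *)

(** Differentials depend only on germs: local representatives of maps compose
    only near a point, because charts carry junk values off their domains. *)
Lemma near_eq_diff (R : numFieldType) (V W : normedModType R) (f g : V -> W) x :
  (\forall y \near x, f y = g y) -> differentiable g x ->
  differentiable f x /\ 'd f x = 'd g x :> (V -> W).
Proof.
move=> fg dg.
have fgx : f x = g x by exact: (nbhs_singleton fg).
have E : f \o shift x = cst (f x) + 'd g x +o_ 0 id.
  apply/eqaddoP => e e0.
  have /eqaddoP/(_ e e0) := diff_locally dg.
  have fg0 : \forall h \near (0 : V), f (h + x) = g (h + x).
    have : ((shift x) @ (0 : V)) `=>` nbhs x.
      rewrite -[X in _ `=>` nbhs X](add0r x).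
      by apply: cvgD; [exact: cvg_id | exact: cvg_cst].
    by move=> /(_ _ fg).
  move=> H; near=> h.
  rewrite (_ : (f \o shift x - (cst (f x) + 'd g x)) h =
     (g \o shift x - (cst (g x) + 'd g x)) h); last first.
    rewrite !fctE /= fgx; congr (_ - _).
    by near: h.
  by near: h.
have eqd : 'd f x = 'd g x :> (V -> W).
  by apply: diff_unique => //; exact: diff_continuous.
split=> //.
apply/diff_locallyP; split.
  by rewrite eqd; exact: diff_continuous.
by rewrite eqd.
Unshelve. all: by end_near.
Qed.

Lemma near_comp_diff (R : numFieldType) (U V W : normedModType R)
    (h : U -> W) (f : U -> V) (g : V -> W) x :
  (\forall y \near x, h y = g (f y)) ->
  differentiable f x -> differentiable g (f x) ->
  differentiable h x /\ forall u, 'd h x u = 'd g (f x) ('d f x u).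
Proof.
move=> hgf df dg.
have [dh ->] := near_eq_diff hgf (differentiable_comp df dg).
by split=> // u; rewrite diff_comp.
Qed.

Lemma near_id_diff (R : numFieldType) (V : normedModType R) (f : V -> V) x :
  (\forall y \near x, f y = y) -> forall u, 'd f x u = u.
Proof.
move=> fid u.
have did : differentiable (@idfun V) x by exact: ex_diff.
have [_ ->] := near_eq_diff (g := idfun) fid did.
by rewrite diff_val.
Qed.

Lemma diff_lincomb (R : numFieldType) (V W : normedModType R) (f : V -> W) x
    (I : finType) (c : I -> R) (e : I -> V) :
  'd f x (\sum_i c i *: e i) = \sum_i c i *: 'd f x (e i).
Proof. by rewrite linear_sum; apply: eq_bigr => i _; rewrite linearZ. Qed.

(** Joint continuity of maps that are linear in their second argument, from the
    continuity of their values on a basis. *)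
Lemma continuous_row_lincomb (R : realType) (n : nat) (W : normedModType R)
    (T : topologicalType) (G : 'I_n -> T * 'rV[R]_n -> W) (z0 : T * 'rV[R]_n) :
  (forall j, {for z0, continuous (G j)}) ->
  {for z0, continuous (fun z : T * 'rV[R]_n => \sum_j z.2 0 j *: G j z)}.
Proof.
move=> cG; apply: cvg_big => [|j _]; first exact: add_continuous.
apply: cvgZ; last exact: cG.
apply: (@continuous_comp _ _ _ snd (fun u : 'rV[R]_n => u 0 j)).
  exact: cvg_snd.
exact: coord_continuous.
Qed.

Lemma continuous_fst_comp (T U W : topologicalType) (f : T -> W) (z : T * U) :
  {for z.1, continuous f} -> {for z, continuous (fun y : T * U => f y.1)}.
Proof.
by move=> cf; apply: (@continuous_comp _ _ _ fst f) => //; exact: cvg_fst.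
Qed.

Lemma continuous_pair (T U W : topologicalType) (f : T -> U) (g : T -> W) x :
  {for x, continuous f} -> {for x, continuous g} ->
  {for x, continuous (fun y => (f y, g y))}.
Proof. by move=> cf cg; exact: cvg_pair cf cg. Qed.

Lemma near_continuous (T U : topologicalType) (f g : T -> U) x :
  (\forall y \near x, f y = g y) -> {for x, continuous g} ->
  {for x, continuous f}.
Proof.
move=> fg cg; rewrite /prop_for /continuous_at (nbhs_singleton fg).
apply: cvg_trans cg; apply: near_eq_cvg; near=> y; apply/esym; near: y.
exact: fg.
Unshelve. all: by end_near.
Qed.

(** Ck_on speaks of the directional derivatives, which agree with the
    differential where the map is differentiable. *)
Lemma near_diff_continuous (R : numFieldType) (V W : normedModType R)
    (U : set V) (f : V -> W) v x : open U -> U x ->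
  (forall y, U y -> differentiable f y) ->
  {for x, continuous (fun y => 'D_v f y)} ->
  {for x, continuous (fun y => 'd f y v)}.
Proof.
move=> oU Ux df; apply: near_continuous; near=> y; rewrite deriveE //.
by apply: df; near: y; apply: open_nbhs_nbhs.
Unshelve. all: by end_near.
Qed.

Lemma compact_unit_sphere (R : realType) (n : nat) :
  compact [set u : 'rV[R]_n | `|u| = 1].
Proof.
apply: bounded_closed_compact.
  by exists 1; split => // x x1 u /= ->; exact: ltW.
rewrite (_ : [set _ | _] = (fun u : 'rV[R]_n => `|u|) @^-1` [set 1]) //.
apply: closed_comp => [u _|]; first exact: norm_continuous.
exact: closed_eq.
Qed.

(** * Tangent map and local frames *)

Section TangentBundle.
Variables (R : realType) (d : nat) (M : topologicalType).
Variable S : smooth_manifold R d M.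
Local Notation V := 'rV[R]_d.
Local Notation coord := Defs.coord.
Implicit Types (a b c : chart R d M) (f g : M -> M).

(** Points near y keep their images in the open set U, in particular in the domain
    of a chart around the image of y. *)
Lemma near_chart a f y (U : set M) : chart_cod a y ->
  {for param a y, continuous f} -> open U -> U (f (param a y)) ->
  \forall z \near y, chart_cod a z /\ U (f (param a z)).
Proof.
move=> ay cf oU Uy; near=> z; split; near: z.
  by apply: open_nbhs_nbhs; split; [exact: chart_cod_open|].
have := @continuous_comp _ _ _ (param a) f y (param_continuous ay) cf.
by move=> /(_ U); apply; exact: open_nbhs_nbhs.
Unshelve. all: by end_near.
Qed.

(** Stated as a plain function, so that the differential stays folded and is only
    handled through the lemmas that follow. *)
Definition local_diff a b f (y u : V) : V := 'd (local_rep a b f) y u.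

Lemma local_diff0 a b f y : local_diff a b f y 0 = 0.
Proof. exact: linear0. Qed.

Lemma local_diffZ a b f y t u :
  local_diff a b f y (t *: u) = t *: local_diff a b f y u.
Proof. exact: linearZ. Qed.

(** The chain rule through an intermediate chart b. *)
Lemma local_rep_comp a b c f g y : local_rep_dom a b f y ->
  {for param a y, continuous f} ->
  differentiable (local_rep a b f) y ->
  differentiable (local_rep b c g) (local_rep a b f y) ->
  differentiable (local_rep a c (g \o f)) y /\
  forall u, local_diff a c (g \o f) y u =
    local_diff b c g (local_rep a b f y) (local_diff a b f y u).
Proof.
move=> [ay bfy] cf df dg; apply: near_comp_diff df dg; near=> z.
have : chart_cod a z /\ chart_dom b (f (param a z)).
  by near: z; apply: near_chart => //; exact: chart_dom_open.
by move=> [_ bz]; rewrite /local_rep /= coordK.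
Unshelve. all: by end_near.
Qed.

Lemma local_diff_id a y u : chart_cod a y -> local_diff a a id y u = u.
Proof.
move=> ay; apply: near_id_diff; near=> z; rewrite /local_rep paramK//.
by near: z; apply: open_nbhs_nbhs; split; [exact: chart_cod_open|].
Unshelve. all: by end_near.
Qed.

(** Weaker than C1_map, but directly closed under composition, which is
    what the tangent maps of iterates need. *)
Definition differentiable_map f : Prop :=
  continuous f /\ forall a b y, atlas S a -> atlas S b ->
    local_rep_dom a b f y -> differentiable (local_rep a b f) y.

Lemma differentiable_map_id : differentiable_map id.
Proof.
split=> [x|a b y Sa Sb]; first exact: cvg_id.
by have [/(_ y)] := atlas_smooth Sa Sb 1%N.
Qed.

Lemma differentiable_map_C1 f : C1_map S f -> differentiable_map f.
Proof.
move=> [cf Cf]; split=> // a b y Sa Sb aby.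
by have [/(_ y aby)] := Cf a b Sa Sb.
Qed.

Lemma local_rep_dom_chart_at a f y : chart_cod a y ->
  local_rep_dom a (chart_at S (f (param a y))) f y.
Proof. by move=> ay; split=> //; exact: chart_at_dom. Qed.

Lemma differentiable_map_comp f g : differentiable_map f ->
  differentiable_map g -> differentiable_map (g \o f).
Proof.
move=> [cf df] [cg dg]; split=> [x|a c y Sa Sc [ay cy]].
  by apply: continuous_comp; [exact: cf|exact: cg].
pose b := chart_at S (f (param a y)).
have Sb : atlas S b by exact: chart_at_atlas.
have aby : local_rep_dom a b f y by exact: local_rep_dom_chart_at.
have bcy : local_rep_dom b c g (local_rep a b f y).
  split; rewrite /local_rep; first exact: coord_cod (aby.2).
  by rewrite coordK//; exact: aby.2.
by have [] := local_rep_comp aby (cf _) (df _ _ _ Sa Sb aby) (dg _ _ _ Sb Sc bcy).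
Qed.

Lemma differentiable_map_iter f n : differentiable_map f ->
  differentiable_map (iter n f).
Proof.
move=> df; elim: n => [|n IH]; first exact: differentiable_map_id.
exact: differentiable_map_comp IH df.
Qed.

Lemma local_diff_comp a b c f g y u :
  atlas S a -> atlas S b -> atlas S c ->
  differentiable_map f -> differentiable_map g ->
  local_rep_dom a b f y -> chart_dom c (g (f (param a y))) ->
  local_diff b c g (local_rep a b f y) (local_diff a b f y u) =
  local_diff a c (g \o f) y u.
Proof.
move=> Sa Sb Sc [cf df] [cg dg] aby cy.
have bcy : local_rep_dom b c g (local_rep a b f y).
  split; rewrite /local_rep; first exact: coord_cod (aby.2).
  by rewrite coordK//; exact: aby.2.
by have [_ ->] :=
  local_rep_comp aby (cf _) (df _ _ _ Sa Sb aby) (dg _ _ _ Sb Sc bcy).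
Qed.

(** The tangent bundle is encoded as pairs of a point and of the coordinates of a
    vector in the chart selected at that point. These coordinates jump with the
    selected chart, so continuity is only meaningful through frame. *)
Definition bundle_map f (p : M * V) : M * V :=
  (f p.1, @tangent_map R d M S f p.1 p.2).

(** The inverse local trivialization of the tangent bundle given by a chart. *)
Definition frame a (z : V * V) : M * V :=
  (param a z.1, tangent_of_chart S a z.1 z.2).

Lemma bundle_mapE f x v : bundle_map f (x, v) =
  (f x, local_diff (chart_at S x) (chart_at S (f x)) f
    (coord (chart_at S x) x) v).
Proof. by []. Qed.

Lemma frameE a y u : frame a (y, u) =
  (param a y, local_diff a (chart_at S (param a y)) id y u).
Proof. by []. Qed.

Lemma bundle_map_id p : bundle_map id p = p.
Proof.
case: p => x v; rewrite bundle_mapE local_diff_id //.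
exact/coord_cod/chart_at_dom.
Qed.

Lemma bundle_map_comp f g p : differentiable_map f -> differentiable_map g ->
  bundle_map (g \o f) p = bundle_map g (bundle_map f p).
Proof.
move=> df dg; case: p => x v; rewrite !bundle_mapE; congr (_, _).
pose a := chart_at S x; have ax : chart_dom a x by exact: chart_at_dom.
have E : param a (coord a x) = x by rewrite coordK.
rewrite -/a -(local_diff_comp v (chart_at_atlas S x) (chart_at_atlas S (f x))
  (chart_at_atlas S (g (f x))) df dg).
- by rewrite /local_rep E.
- by split; rewrite ?E; [exact: coord_cod|exact: chart_at_dom].
- by rewrite E; exact: chart_at_dom.
Qed.

Lemma bundle_map_iter f n p : differentiable_map f ->
  bundle_map (iter n f) p = iter n (bundle_map f) p.
Proof.
move=> df; elim: n => [|n IH]; first exact: bundle_map_id.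
by rewrite iterS -IH -bundle_map_comp //; exact: differentiable_map_iter.
Qed.

(** In local trivializations the tangent map becomes the differential of the
    local representative. Both sides are differentials of the composite
    read from the chart a to the chart selected at the image point. *)
Lemma bundle_map_frame a b f y u : atlas S a -> atlas S b ->
  differentiable_map f -> local_rep_dom a b f y ->
  bundle_map f (frame a (y, u)) =
  frame b (local_rep a b f y, local_diff a b f y u).
Proof.
move=> Sa Sb df aby; have [ay by_] := aby.
have E : param b (local_rep a b f y) = f (param a y) by rewrite /local_rep coordK.
rewrite (frameE a y u).
rewrite (bundle_mapE f (param a y)).
rewrite (frameE b (local_rep a b f y)).
rewrite [param b _]E; apply: (f_equal (pair _)).
have did := differentiable_map_id.
rewrite (local_diff_comp u Sa Sb (chart_at_atlas S (f (param a y))) df did) //;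
  last exact: chart_at_dom.
have ax := local_rep_dom_chart_at id ay.
by rewrite (local_diff_comp u Sa (chart_at_atlas S (param a y))
  (chart_at_atlas S (f (param a y))) did df ax) //; exact: chart_at_dom.
Qed.

(** The two changes of coordinates between the chart a and the chart selected at x
    compose to the identity, by the chain rule. *)
Lemma tangent_of_chart_bij a x : atlas S a -> chart_dom a x ->
  exists T : V -> V, [/\ cancel T (fun u => (frame a (coord a x, u)).2),
    cancel (fun u => (frame a (coord a x, u)).2) T & T 0 = 0].
Proof.
move=> Sa ax; pose c := chart_at S x; have cx : chart_dom c x by exact: chart_at_dom.
have Sc : atlas S c by exact: chart_at_atlas.
exists (local_diff c a id (coord c x)).
have did := differentiable_map_id.
have Ea : param a (coord a x) = x by rewrite coordK.
have Ec : param c (coord c x) = x by rewrite coordK.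
have ra : local_rep a c id (coord a x) = coord c x by rewrite /local_rep Ea.
have rc : local_rep c a id (coord c x) = coord a x by rewrite /local_rep Ec.
have aa : chart_cod a (coord a x) by exact: coord_cod.
have cc : chart_cod c (coord c x) by exact: coord_cod.
split=> [v|u|]; last exact: local_diff0.
- rewrite frameE /= Ea -/c -{1}rc (local_diff_comp v Sc Sa Sc did did).
  + exact: local_diff_id.
  + by split=> //=; rewrite Ec.
  + by rewrite Ec.
- rewrite frameE /= Ea -/c -{1}ra (local_diff_comp u Sa Sc Sa did did).
  + exact: local_diff_id.
  + by split=> //=; rewrite Ea.
  + by rewrite Ea.
Qed.

(** Continuity for the topology of the tangent bundle, tested in all local
    trivializations. *)
Definition bundle_continuous (h : M * V -> R) : Prop :=
  forall a (z : V * V), atlas S a -> chart_cod a z.1 ->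
    {for z, continuous (h \o frame a)}.

End TangentBundle.

(** * Continuity on the tangent bundle *)

Section BundleContinuity.
Variables (R : realType) (d : nat) (M : topologicalType).
Variable S : smooth_manifold R d M.
Local Notation V := 'rV[R]_d.
Local Notation coord := Defs.coord.
Implicit Types (a b c : chart R d M) (f g : M -> M).

Lemma local_diff_lincomb a b f y u :
  local_diff a b f y u = \sum_j u 0 j *: local_diff a b f y 'e_j.
Proof.
exact: (etrans (f_equal (local_diff a b f y) (row_sum_delta u))
  (diff_lincomb (local_rep a b f) y (fun j => u 0 j) (fun j => 'e_j))).
Qed.

Lemma local_diff_continuous a b f v y : C1_map S f -> atlas S a -> atlas S b ->
  local_rep_dom a b f y ->
  {for y, continuous (fun z => local_diff a b f z v)}.
Proof.
move=> [cf Cf] Sa Sb aby; have [df Cdf] := Cf a b Sa Sb.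
have {}Cdf := Cdf v y aby.
apply: (near_diff_continuous (U := (local_rep_dom a b f)^°)) Cdf.
- exact: open_interior.
- have [ay bz] := aby; exact: (near_chart ay (cf _) (@chart_dom_open _ _ _ b) bz).
- by move=> z /interior_subset; exact: df.
Qed.

(** In frames the tangent map is (y, u) |-> (F y, dF_y u) with F a C^1 local
    representative; this is jointly continuous since dF_y u is linear in u. *)
Lemma bundle_continuous_comp f (h : M * V -> R) : C1_map S f ->
  bundle_continuous S h -> bundle_continuous S (h \o bundle_map S f).
Proof.
move=> Cf ch a [y u] Sa /= ay; have df := differentiable_map_C1 Cf.
pose b := chart_at S (f (param a y)); have Sb : atlas S b := chart_at_atlas S _.
have aby : local_rep_dom a b f y := local_rep_dom_chart_at S f ay.
pose G (z : V * V) := (local_rep a b f z.1, local_diff a b f z.1 z.2).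
apply: (@near_continuous _ _ _ ((h \o frame S b) \o G)).
  have U : nbhs y (local_rep_dom a b f).
    have [_ bz] := aby.
    exact: (near_chart ay (Cf.1 _) (@chart_dom_open _ _ _ b) bz).
  have : nbhs (y, u) ((local_rep_dom a b f) `*` setT).
    by exists (local_rep_dom a b f, setT) => //=; split=> //; exact: filterT.
  apply: filterS => -[y' u'] [/= aby' _].
  by rewrite (bundle_map_frame _ Sa Sb df aby').
apply: continuous_comp; last first.
  by apply: ch => //; exact: (coord_cod aby.2).
apply: continuous_pair.
  apply: continuous_fst_comp.
  exact: differentiable_continuous (df.2 _ _ _ Sa Sb aby).
rewrite (_ : (fun z => _) = fun z : V * V =>
    \sum_j z.2 0 j *: local_diff a b f z.1 'e_j); last first.
  by apply/funext => z; exact: local_diff_lincomb.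
apply: continuous_row_lincomb => j.
apply: (continuous_fst_comp (f := fun y => local_diff a b f y 'e_j)).
exact: local_diff_continuous.
Qed.

Lemma bundle_continuous_iter f (h : M * V -> R) n : C1_map S f ->
  bundle_continuous S h -> bundle_continuous S (h \o iter n (bundle_map S f)).
Proof.
move=> Cf ch; elim: n => // n IH.
rewrite (_ : h \o _ = (h \o iter n (bundle_map S f)) \o bundle_map S f).
  exact: bundle_continuous_comp.
by apply/funext => p /=; rewrite -iterS iterSr.
Qed.

Definition metric_square (g : riemannian_metric S) (p : M * V) : R :=
  @metric R d M S g p.1 p.2 p.2.

Lemma metric_sumZl (g : riemannian_metric S) x (I : Type) (r : seq I)
    (k : I -> R) (e : I -> V) (w : V) :
  @metric R d M S g x (\sum_(i <- r) k i *: e i) w =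
  \sum_(i <- r) k i * @metric R d M S g x (e i) w.
Proof.
elim: r => [|i r IH]; last by rewrite !big_cons metric_linear IH.
rewrite !big_nil; have := @metric_linear _ _ _ _ g x 1 0 0 w.
by rewrite scaler0 addr0 mul1r => /eqP; rewrite -subr_eq subrr eq_sym => /eqP.
Qed.

Lemma metric_square_scale (g : riemannian_metric S) x t v :
  metric_square g (x, t *: v) = t ^+ 2 * metric_square g (x, v).
Proof.
have Zl w : @metric R d M S g x (t *: v) w = t * @metric R d M S g x v w.
  by have := metric_sumZl g x [:: tt] (fun=> t) (fun=> v) w; rewrite !big_seq1.
by rewrite /metric_square /= Zl Defs.metric_sym Zl mulrA expr2.
Qed.

(** In a frame the squared length is a quadratic form in u whose coefficients, the
    products of the basis vectors, depend smoothly on the point. *)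
Lemma bundle_continuous_metric (g : riemannian_metric S) :
  bundle_continuous S (metric_square g).
Proof.
move=> a [y u] Sa /= ay.
pose G i j (z : V) : R := @metric R d M S g (param a z)
  (tangent_of_chart S a z 'e_i) (tangent_of_chart S a z 'e_j).
rewrite (_ : _ \o _ = fun z : V * V =>
    \sum_i z.2 0 i *: \sum_j z.2 0 j *: G i j z.1); last first.
  apply/funext => -[z w] /=; rewrite /metric_square /frame /=.
  have E : tangent_of_chart S a z w =
      \sum_j w 0 j *: (tangent_of_chart S a z 'e_j : V).
    exact: local_diff_lincomb.
  rewrite E metric_sumZl; apply: eq_bigr => i _; congr (_ * _).
  rewrite Defs.metric_sym metric_sumZl; apply: eq_bigr => j _; congr (_ * _).
  exact: Defs.metric_sym.
apply: continuous_row_lincomb => i; apply: continuous_row_lincomb => j.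
apply: (continuous_fst_comp (f := G i j)).
have [/(_ y ay) + _] := @metric_smooth _ _ _ _ g a 'e_i 'e_j Sa 1%N.
exact: differentiable_continuous.
Qed.
End BundleContinuity.

(** * Compactness of the directions over a compact set *)

Section BundleCompactness.
Variables (R : realType) (d : nat) (M : topologicalType).
Variable S : smooth_manifold R d M.
Local Notation V := 'rV[R]_d.
Local Notation coord := Defs.coord.
Implicit Types (a b c : chart R d M) (f g : M -> M).

Definition nonzero_over (L : set M) : set (M * V) :=
  [set p | L p.1 /\ p.2 != 0].

Lemma frame_nonzero a x u : atlas S a -> chart_dom a x ->
  u != 0 -> (frame S a (coord a x, u)).2 != 0.
Proof.
move=> Sa ax; have [T [_ TK T0]] := tangent_of_chart_bij Sa ax.
by apply: contra_neq => E; rewrite -(TK u) E T0.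
Qed.

Lemma frame_surj a x v : atlas S a -> chart_dom a x -> v != 0 ->
  exists2 u, u != 0 & frame S a (coord a x, u) = (x, v).
Proof.
move=> Sa ax v0; have [T [TK _ T0]] := tangent_of_chart_bij Sa ax.
have E : frame S a (coord a x, T v) = (x, v).
  by rewrite [LHS]surjective_pairing TK /= coordK.
exists (T v) => //; apply: contra_neq v0 => Tv.
rewrite -(TK v) Tv; exact: local_diff0.
Qed.

(** By homogeneity the condition need only be checked on unit vectors in the frame
    of the chart a. Their sphere is compact, so finitely many of the h i serve
    all the directions at x, and still do so at nearby points. *)
Lemma local_cover a x (h : nat -> M * V -> R) :
  (forall i, bundle_continuous S (h i)) ->
  (forall i x t v, 0 < t -> 0 < h i (x, v) -> 0 < h i (x, t *: v)) ->
  atlas S a -> chart_dom a x ->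
  (forall v, v != 0 -> exists i, 0 < h i (x, v)) ->
  \forall y \near x & k \near \oo,
    forall v, v != 0 -> exists2 i, (i < k)%N & 0 < h i (y, v).
Proof.
move=> ch hZ Sa ax hx; have ay := coord_cod ax.
pose Q (z : V * nat) (u : V) :=
  exists2 i, (i < z.2)%N & 0 < h i (frame S a (z.1, u)).
have : \forall z \near filter_prod (nbhs (coord a x)) \oo,
    [set u : V | `|u| = 1] `<=` Q z.
  have /compact_near_coveringP := @compact_unit_sphere R d; apply => u /= u1.
  have u0 : u != 0 by rewrite -normr_eq0 u1 oner_neq0.
  have [i hi] := hx _ (frame_nonzero Sa ax u0).
  have : {for (coord a x, u), continuous (h i \o frame S a)} by exact: ch.
  move=> /(_ [set r | 0 < r]) [|[A B] /= [Ax Bu] AB].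
    by apply: open_nbhs_nbhs; split; [exact: open_gt|rewrite /= /frame /= coordK].
  exists (B, A `*` [set k | (i < k)%N]) => /=.
    split=> //; exists (A, [set k | (i < k)%N]) => //=; split=> //.
    exact: nbhs_infty_gt.
  by move=> [w [y k]] /= [Bw [Ay ik]]; exists i => //; exact: (AB (y, w)).
move=> [[A B] /= [Ax Boo] AB].
exists (chart_dom a `&` coord a @^-1` A, B) => /=.
  split=> //; apply: filterI.
    by apply: open_nbhs_nbhs; split; [exact: chart_dom_open|].
  exact: (Defs.coord_continuous ax Ax).
move=> [y k] /= [[ady Ay] Bk] v v0.
have [u u0 uE] := frame_surj Sa ady v0.
have nu : 0 < `|u| by rewrite normr_gt0.
have [|i ik hi] := AB (coord a y, k) (conj Ay Bk) (`|u|^-1 *: u).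
  by rewrite /= normrZ normfV normr_id mulVf// normr_eq0.
exists i => //.
have := hi; rewrite /= frameE local_diffZ.
have -> : v = `|u| *: (`|u|^-1 *: v) by rewrite scalerA mulfV ?gt_eqF// scale1r.
move=> H; apply: hZ => //; move: H.
by have := uE; rewrite frameE => -[-> <-].
Qed.

(** Compactness of the unit sphere bundle over L, in the form of finite subcovers
    by the cones where some h i is positive. *)
Lemma nonzero_cover (L : set M) (h : nat -> M * V -> R) : compact L ->
  (forall i, bundle_continuous S (h i)) ->
  (forall i x t v, 0 < t -> 0 < h i (x, v) -> 0 < h i (x, t *: v)) ->
  (forall p, nonzero_over L p -> exists i, 0 < h i p) ->
  exists k, forall p, nonzero_over L p -> exists2 i, (i < k)%N & 0 < h i p.
Proof.
move=> /compact_near_coveringP cL ch hZ hL.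
pose P (k : nat) (x : M) :=
  forall v, v != 0 -> exists2 i, (i < k)%N & 0 < h i (x, v).
have [|k _ Hk] := cL nat \oo P _.
  move=> x Lx; apply: (local_cover ch hZ (chart_at_atlas S x)).
    exact: chart_at_dom.
  by move=> v v0; exact: hL.
by exists k => -[x v] [/= Lx v0]; exact: (Hk k (leqnn k) x Lx v v0).
Qed.

End BundleCompactness.

(** * Lyapunov exponents as Birkhoff averages *)

Section TangentCocycle.
Variables (R : realType) (d : nat) (M : topologicalType).
Variables (S : smooth_manifold R d M) (g : riemannian_metric S).
Variables (f : M -> M) (L : set M).
Hypothesis Cf : C1_map S f.
Hypothesis fL : f @` L `<=` L.
Hypothesis ncL : forall x, L x -> ~ critical_point S f x.
Local Notation V := 'rV[R]_d.
Local Notation Df := (bundle_map S f).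
Local Notation E := (nonzero_over (R := R) (d := d) L).
Local Notation q := (metric_square g).

(** The squared length is used throughout, so the rates of growth are
    twice the Lyapunov exponents. *)
Definition log_expansion (p : M * V) : R := ln (q (Df p)) - ln (q p).
Local Notation sum_log := (birkhoff_sum Df log_expansion).

Lemma metric_square_gt0 p : E p -> 0 < q p.
Proof. by case: p => x v [_ v0]; exact: Defs.metric_pos. Qed.

Lemma bundle_map_nonzero p : E p -> E (Df p).
Proof.
case: p => x v [/= Lx v0]; split; first by apply: fL; exists x.
apply/negP => /eqP /= Dv0; apply: (ncL Lx); apply/eqP.
apply/det0P; exists v => //.
exact: (etrans (mul_rV_lin1 _ v) Dv0).
Qed.

Lemma bundle_map_iter_nonzero n p : E p -> E (iter n Df p).
Proof. exact: iter_invariant bundle_map_nonzero n p. Qed.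

Lemma sum_logE n p : sum_log n p = ln (q (iter n Df p)) - ln (q p).
Proof.
rewrite /birkhoff_sum.
rewrite -(big_mkord xpredT (fun i => log_expansion (iter i Df p))).
by rewrite (telescope_sumr (fun i => ln (q (iter i Df p)))).
Qed.

(** The right-hand side is continuous on the whole tangent bundle and homogeneous
    in the vector, as nonzero_cover requires, whereas log q is singular on the
    zero vectors. *)
Lemma lt_sum_log n (c : R) p : E p ->
  (c < sum_log n p) = (0 < q (iter n Df p) - expR c * q p).
Proof.
move=> Ep; have q0 := metric_square_gt0 Ep.
have qn := metric_square_gt0 (bundle_map_iter_nonzero n Ep).
rewrite sum_logE subr_gt0 ltrBrDr -ltr_expR expRD lnK ?posrE// lnK ?posrE//.
Qed.

Lemma bundle_mapZ x t (v : V) :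
  Df (x, t *: v) = ((Df (x, v)).1, t *: (Df (x, v)).2).
Proof. by rewrite !bundle_mapE local_diffZ. Qed.

Lemma metric_square_iterZ n x t v :
  q (iter n Df (x, t *: v)) = t ^+ 2 * q (iter n Df (x, v)).
Proof.
have -> : iter n Df (x, t *: v) =
    ((iter n Df (x, v)).1, t *: (iter n Df (x, v)).2).
  elim: n => //= n ->; case: (iter n Df (x, v)) => y w.
  exact: bundle_mapZ.
by rewrite metric_square_scale; case: (iter n Df (x, v)).
Qed.

Lemma log_expansion_compact : compact L -> birkhoff_compact Df log_expansion E.
Proof.
move=> cL m c Hm.
pose h i p := q (iter (m i) Df p) - expR (c i) * q p.
have [i||p Ep|k Hk] := @nonzero_cover R d M S L h cL.
- move=> a z Sa az.
  have cn := bundle_continuous_iter (n := m i) Cf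
    (bundle_continuous_metric (g := g)) Sa az.
  have c0 := bundle_continuous_metric (g := g) Sa az.
  exact: (cvgB cn (cvgM (cvg_cst (expR (c i))) c0)).
- move=> i x t v t0; rewrite /h metric_square_iterZ metric_square_scale.
  by rewrite mulrCA -mulrBr pmulr_rgt0// exprn_gt0.
- by have [i ci] := Hm p Ep; exists i; rewrite /h -lt_sum_log.
- exists k => p Ep; have [i ik hi] := Hk p Ep.
  by exists i => //; rewrite lt_sum_log.
Qed.

Lemma log_normE n x v : E (x, v) ->
  ((n%:R^-1)%:E *
    lne (tangent_norm g (@tangent_map R d M S (iter n f) x v))%:E)%E =
  ((sum_log n (x, v) + ln (q (x, v))) / 2 / n%:R)%:E.
Proof.
move=> Ep; have qn := metric_square_gt0 (bundle_map_iter_nonzero n Ep).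
have -> : tangent_norm g (@tangent_map R d M S (iter n f) x v) =
    Num.sqrt (q (iter n Df (x, v))).
  by rewrite -(bundle_map_iter _ _ (differentiable_map_C1 Cf)).
rewrite lne_EFin ?sqrtr_gt0// sum_logE subrK -EFinM; congr EFin.
have -> : ln (q (iter n Df (x, v))) = ln (Num.sqrt (q (iter n Df (x, v)))) *+ 2.
  by rewrite -lnXn ?sqrtr_gt0// sqr_sqrtr// ltW.
by rewrite -[X in X / 2]mulr_natr mulfK// mulrC.
Qed.

(** The sums are normalized by log q (x, v), whose contribution to the average
    vanishes in the limit. *)
Lemma lyapunov_exponentP l : lyapunov_exponents g f L l <->
  exists2 p, E p & sum_log n p / n%:R @[n --> \oo] --> 2 * l.
Proof.
split=> [[x [v [Lx v0]]]|[[x v] Ep Sl]].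
  have Ep : E (x, v) by [].
  under eq_fun do rewrite log_normE//.
  move=> /fine_cvg Sl; exists (x, v) => //.
  have : 2 * (fine \o (fun n =>
      ((sum_log n (x, v) + ln (q (x, v))) / 2 / n%:R)%:E)) n
      - ln (q (x, v)) * n%:R^-1 @[n --> \oo] --> 2 * l.
    rewrite -[X in _ --> X]subr0; apply: cvgB; last exact: cvg_divn0.
    by apply: cvgM => //; exact: cvg_cst.
  apply: cvg_trans; apply: near_eq_cvg; near=> n => /=.
  by field; rewrite pnatr_eq0 -lt0n; near: n; exact: nbhs_infty_gt.
have [Lx v0] := Ep.
exists x, v; split => //.
under eq_fun do rewrite log_normE//.
apply: cvg_EFin; first by near=> n.
have : 2^-1 * (sum_log n (x, v) / n%:R) + (ln (q (x, v)) / 2) * n%:R^-1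
    @[n --> \oo] --> l.
  rewrite -[X in _ --> X]addr0; apply: cvgD; last exact: cvg_divn0.
  rewrite -[l](mulKf (_ : 2 != 0)) ?pnatr_eq0//.
  by apply: cvgM => //; exact: cvg_cst.
apply: cvg_trans; apply: near_eq_cvg; near=> n => /=.
by field; rewrite pnatr_eq0 -lt0n; near: n; exact: nbhs_infty_gt.
Unshelve. all: by end_near.
Qed.

End TangentCocycle.

Unset Implicit Arguments.

Theorem corollary1 (R : realType) (d : nat) (hd : (1 <= d)%N)
    (M : topologicalType) (S : smooth_manifold R d M)
    (g : riemannian_metric S) (hM : compact [set: M])
    (f : M -> M) (hf : C1_map S f)
    (Lam : set M) (hLc : compact Lam) (hLi : f @` Lam `<=` Lam)
    (hLcrit : forall x, Lam x -> ~ critical_point S f x)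
    (hpos : forall l' : R, lyapunov_exponents g f Lam l' -> 0 < l') :
  exists l : R, 0 < l /\
    forall l' : R, lyapunov_exponents g f Lam l' -> l < l'.
Proof.
have expP := lyapunov_exponentP g hf hLi hLcrit.
have [[l0 /expP[p0 Ep0 Sp0]]|no_exponent] :=
    pselect (exists l0, lyapunov_exponents g f Lam l0); last first.
  by exists 1; split=> // l' expl'; case: no_exponent; exists l'.
have [alpha [p Ep Sp] alpha_min] := minimal_birkhoff_limit
  (bundle_map_nonzero hLi hLcrit)
  (log_expansion_compact (g := g) hf hLi hLcrit hLc) Ep0 Sp0.
have alpha0 : 0 < alpha / 2.
  by apply: hpos; apply/expP; exists p => //; rewrite mulrC divfK ?pnatr_eq0.
(* alpha / 2 is the least exponent; halving it once more makes the bound strict. *)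
exists (alpha / 4); split; first by lra.
by move=> l' /expP[p' Ep' Sp']; have := alpha_min _ _ Ep' Sp'; lra.
Qed.
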